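(* Let $X$ be a locally convex space over the real or complex numbers, $T:X\to X$ a continuous linear operator, and $x\in X$. Then the following are equivalent: (1) The convex hull of the orbit $Orb(T,x)$ is dense in $X$. (2) For every non-zero continuous linear functional $f$ on $X$ we have $\sup \{Re(f(y)) : y\in Orb(T,x)\}=\infty$.
   Context: For an operator $T$ on $X$ and $x\in X$, the orbit is $Orb(T,x)=\{T^n x : n=0,1,2,\ldots\}$. *)

(* Defs.v *)
From HB Require Import structures.
From mathcomp Require Import all_boot all_order all_algebra complex.
From mathcomp Require Import boolp classical_sets functions reals ereal.
From mathcomp Require Import convex topology normedtype.

Set Implicit Arguments.
Unset Strict Implicit.
Unset Printing Implicit Defensive.

Import Order.TTheory GRing.Theory Num.Theory.
Import numFieldTopology.Exports.

Local Open Scope classical_set_scope.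
Local Open Scope ring_scope.

Definition Orb (U : Type) (T : U -> U) (x : U) : set U :=
  range (fun n : nat => iter n T x).

(* Over K = R[i] too, the weights of a convex combination are real: 0 <= t <= 1
   in the partial order of a numDomainType forces t to be real. *)
Definition convex_hull (K : numDomainType) (M : lmodType K) (A : set M)
    : set M :=
  smallest (fun C : set M => convex_set C) A.

(* Main.v *)
(** A hull that is not dense misses a neighbourhood of some point, so
    Hahn-Banach yields a nonzero continuous real-linear functional bounded above
    on the hull; over the complex numbers it is the real part of the linear
    functional [f x - i f (i x)].  Conversely a bound on the real part over the
    set passes to the hull, and no nonzero functional is bounded above on a
    dense set.

    Hahn-Banach itself is obtained without extending partially defined
    functionals: a pointwise minimal sublinear functional is already linear. *)

Require Import Defs.
From HB Require Import structures.
From mathcomp Require Import all_boot all_order all_algebra complex.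
From mathcomp Require Import boolp classical_sets functions reals ereal.
From mathcomp Require Import convex topology normedtype.
From mathcomp Require Import interval_inference ring lra.

Set Implicit Arguments.
Unset Strict Implicit.
Unset Printing Implicit Defensive.

Import Order.TTheory GRing.Theory Num.Theory.
Import numFieldTopology.Exports.

Local Open Scope classical_set_scope.
Local Open Scope ring_scope.

(** * Convexity with explicit weights *)

Section ConvexSet.
Variables (K : numDomainType) (V : lmodType K).
Implicit Types (A : set V) (x y : V) (a b : K).

Lemma convex_setP A : convex_set A <->
  forall x y a b, 0 <= a -> 0 <= b -> a + b = 1 -> A x -> A y ->
    A (a *: x + b *: y).
Proof.
split=> [cA x y a b a0 b0 ab Ax Ay|cA x y l].
  have a1 : a <= 1 by rewrite -ab lerDl.
  have -> : b = 1 - a by rewrite -ab addrAC subrr add0r.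
  by have := cA x y (Itv01 a0 a1) (mem_set Ax) (mem_set Ay); rewrite inE.
rewrite !inE => Ax Ay.
apply: (cA x y l%:num (1 - l%:num)) => //; last by rewrite addrC subrK.
Qed.

End ConvexSet.

(** * Sublinear functionals and the Hahn-Banach theorem *)

Section Sublinear.
Variables (R : realType) (V : lmodType R).
Implicit Types (p q : V -> R) (x y : V).

Definition sublinear p :=
  (forall x y, p (x + y) <= p x + p y) /\
  (forall t x, 0 <= t -> p (t *: x) = t * p x).

Lemma sublinear0 p : sublinear p -> p 0 = 0.
Proof. by case=> _ /(_ 0 0 (lexx _)); rewrite scale0r mul0r. Qed.

Lemma sublinear_ge p x : sublinear p -> - p (- x) <= p x.
Proof.
move=> sp; have := sp.1 x (- x); rewrite subrr sublinear0 // => h; lra.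
Qed.

(** The reverse inequality for homogeneity is the assumed one applied to the scalar [t^-1] and the
    vector [t *: x]. *)
Lemma sublinearW p : p 0 = 0 -> (forall x y, p (x + y) <= p x + p y) ->
  (forall t x, 0 < t -> p (t *: x) <= t * p x) -> sublinear p.
Proof.
move=> p0 pD pZ; split=> // t x; rewrite le_eqVlt => /predU1P[<-|t0].
  by rewrite scale0r mul0r.
apply/eqP; rewrite eq_le pZ //= -ler_pdivlMl //.
apply: le_trans (pZ _ _ _); last by rewrite invr_gt0.
by rewrite scalerA mulVf ?scale1r // gt_eqF.
Qed.

Lemma le_inf_add (A B : set R) r : A !=set0 -> B !=set0 ->
  (forall a b, A a -> B b -> r <= a + b) -> r <= inf A + inf B.
Proof.
move=> A0 B0 rAB; rewrite -lerBlDr; apply: lb_le_inf => // a Aa.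
rewrite lerBlDr -lerBlDl; apply: lb_le_inf => // b Bb.
by rewrite lerBlDl; exact: rAB.
Qed.

Lemma le_mul_inf (A : set R) r t : 0 < t -> A !=set0 ->
  (forall a, A a -> r <= t * a) -> r <= t * inf A.
Proof.
move=> t0 A0 rA; rewrite -ler_pdivrMl //; apply: lb_le_inf => // a Aa.
by rewrite ler_pdivrMl //; exact: rA.
Qed.

Section Shift.
Variables (p : V -> R) (y : V).
Hypothesis sp : sublinear p.

Let S x := [set p (x + t *: y) - t * p y | t in [set t : R | 0 <= t]].
(** This is the largest sublinear functional below [p] whose value at [- y] is at most [- p y]. *)
Definition sublinear_shift x := inf (S x).

Let S_neq0 x : S x !=set0.
Proof. by exists (p (x + 0 *: y) - 0 * p y), 0 => /=. Qed.

Let shift_le x t : 0 <= t -> sublinear_shift x <= p (x + t *: y) - t * p y.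
Proof.
move=> t0; apply: ge_inf; last by exists t.
(* The lower bound comes from [s *: y = (x + s *: y) + (- x)] and subadditivity. *)
exists (- p (- x)) => _ [s /= s0 <-].
have := sp.1 (x + s *: y) (- x).
rewrite addrAC subrr add0r sp.2 // => h; lra.
Qed.

Lemma sublinear_shift_le x : sublinear_shift x <= p x.
Proof. by have := shift_le x (lexx 0); rewrite scale0r addr0 mul0r subr0. Qed.

Lemma sublinear_shift_add x : sublinear_shift x <= p (x + y) - p y.
Proof. by have := shift_le x ler01; rewrite scale1r mul1r. Qed.

(** Parameters [s] for [x1] and [t] for [x2] yield the parameter [s + t] for [x1 + x2]; scaling the
    vector by [t > 0] turns the parameter [s] into [t * s]. *)
Lemma sublinear_shiftP : sublinear sublinear_shift.
Proof.
apply: sublinearW => [|x1 x2|t x t0].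
- apply/eqP; rewrite eq_le; apply/andP; split.
    by rewrite -(sublinear0 sp) sublinear_shift_le.
  apply: lb_le_inf => // _ [t /= t0 <-].
  by rewrite add0r sp.2 // subrr.
- apply: le_inf_add => // _ _ [s /= s0 <-] [t /= t0 <-].
  apply: le_trans (shift_le _ (addr_ge0 s0 t0)) _.
  have := sp.1 (x1 + s *: y) (x2 + t *: y).
  by rewrite addrACA -scalerDl => h; lra.
- apply: le_mul_inf => // _ [s /= s0 <-].
  apply: le_trans (shift_le _ (mulr_ge0 (ltW t0) s0)) _.
  by rewrite -scalerA -scalerDr sp.2 ?(ltW t0) // mulrBr mulrA.
Qed.

End Shift.

Lemma ex_minimal_sublinear p : sublinear p ->
  exists q, [/\ sublinear q, (forall x, q x <= p x) &
    forall r, sublinear r -> (forall x, r x <= q x) -> r = q].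
Proof.
move=> sp.
pose T := {q : V -> R | sublinear q /\ forall x, q x <= p x}.
(* The order is reversed, so that a maximal element given by Zorn's lemma is a pointwise minimal
   functional. *)
pose Rel (q r : T) := `[< forall x, sval r x <= sval q x >].
have p_lb (q : T) x : - p (- x) <= sval q x.
  have [sq qp] := svalP q.
  by apply: le_trans (sublinear_ge x sq); rewrite lerN2.
have [||||q qmin] := @Zorn T Rel.
- by move=> q; apply/asboolP.
- move=> q r s /asboolP qr /asboolP rs; apply/asboolP => x.
  exact: le_trans (rs x) (qr x).
- move=> q r /asboolP qr /asboolP rq; case: q r qr rq => q qP [r rP] /= qr rq.
  apply/eq_exist/funext => x.
  by apply/eqP; rewrite eq_le rq qr.
(* An empty chain is bounded by [p] itself; otherwise the pointwise infimum works, being finite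
   because [- p (- x)] bounds every member from below. *)
- move=> A totA; have [->|/eqP/set0P[q0 Aq0]] := pselect (A = set0).
    by exists (exist _ p (conj sp (fun x => lexx _))).
  pose I x := [set sval q x | q in A]; pose m x := inf (I x).
  have I0 x : I x !=set0 by exists (sval q0 x), q0.
  have m_le (q : T) x : A q -> m x <= sval q x.
    move=> Aq; apply: ge_inf; last by exists q.
    by exists (- p (- x)) => _ [r _ <-].
  have sm : sublinear m.
    apply: sublinearW => [|x y|t x t0].
    - rewrite /m (_ : I 0 = [set 0]) ?inf1 //; apply/seteqP; split=> /=.
        by move=> _ [q _ <-]; exact: sublinear0 (svalP q).1.
      by move=> _ ->; exists q0 => //; exact: sublinear0 (svalP q0).1.
    - apply: le_inf_add => // _ _ [q1 Aq1 <-] [q2 Aq2 <-].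
      (* The two infima may be approached along different members; totality of the chain supplies
         one member below both. *)
      have [q [Aq qq1 qq2]] : exists q : T, [/\ A q,
          forall z, sval q z <= sval q1 z & forall z, sval q z <= sval q2 z].
        by case: (totA _ _ Aq1 Aq2) => /asboolP le_q; [exists q2|exists q1].
      apply: le_trans (m_le q _ Aq) _.
      by rewrite (le_trans ((svalP q).1.1 x y)) // lerD.
    - apply: le_mul_inf => // _ [q Aq <-].
      by rewrite -(svalP q).1.2 ?(ltW t0) // m_le.
  have mp x : m x <= p x by exact: le_trans (m_le q0 x Aq0) ((svalP q0).2 x).
  by exists (exist _ m (conj sm mp)) => q Aq; apply/asboolP => x /=; exact: m_le.
- have [sq qp] := svalP q.
  exists (sval q); split=> // r sr rq.
  pose r' : T := exist _ r (conj sr (fun x => le_trans (rq x) (qp x))).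
  by rewrite -(qmin r') //; apply/asboolP.
Qed.

(* If [q] is minimal then [sublinear_shift q y = q], hence
   [q x + q y <= q (x + y)] for all [x] and [y]. *)
Lemma minimal_sublinear_linear q : sublinear q ->
  (forall r, sublinear r -> (forall x, r x <= q x) -> r = q) ->
  linear (q : V -> R^o).
Proof.
move=> sq qmin.
have qD x y : q (x + y) = q x + q y.
  apply/eqP; rewrite eq_le sq.1 /= -lerBrDr.
  have {1}<- // := qmin _ (sublinear_shiftP y sq) (sublinear_shift_le y sq).
  exact: sublinear_shift_add.
have qN x : q (- x) = - q x.
  by apply/eqP; rewrite -addr_eq0 -qD addNr sublinear0.
move=> t x y; rewrite qD; congr (_ + _).
have [t0|t0] := leP 0 t; first exact: sq.2.
rewrite -[LHS]opprK -qN -scaleNr sq.2; last by rewrite oppr_ge0 ltW.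
by rewrite mulNr opprK.
Qed.

(* A minimal sublinear functional below [sublinear_shift p y], which sends [- y]
   to at most [- p y]. *)
Theorem hahn_banach_sublinear p y : sublinear p ->
  exists f : {linear V -> R^o}, (forall x, f x <= p x) /\ f y = p y.
Proof.
move=> sp.
have [q [sq q_le qmin]] := ex_minimal_sublinear (sublinear_shiftP y sp).
have qp x : q x <= p x := le_trans (q_le x) (sublinear_shift_le y sp x).
pose F := GRing.isLinear.Build R V R^o *:%R q (minimal_sublinear_linear sq qmin).
pose f : {linear V -> R^o} := HB.pack q F.
exists f; split => //; apply/eqP; rewrite eq_le qp /=.
have := le_trans (q_le (- y)) (sublinear_shift_add y sp (- y)).
have : q (- y) = - q y by exact: (linearN f).
by rewrite addNr sublinear0 // => -> h; lra.
Qed.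

End Sublinear.

(** * The Minkowski gauge of a convex absorbing set *)

Section Gauge.
Variables (R : realType) (V : lmodType R) (D : set V).
Hypothesis convD : convex_set D.
Hypothesis absD : forall x, exists2 t : R, 0 < t & D (t *: x).

Let G x := [set t | 0 < t /\ D (t^-1 *: x)].
Definition gauge x := inf (G x).

Let G_neq0 x : G x !=set0.
Proof.
have [t t0 Dx] := absD x.
by exists t^-1; split; rewrite ?invr_gt0 // invrK.
Qed.

Let gauge_le x t : 0 < t -> D (t^-1 *: x) -> gauge x <= t.
Proof. by move=> t0 Dx; apply: ge_inf => //; exists 0 => s [/ltW]. Qed.

Let gauge_ge0 x : 0 <= gauge x.
Proof. by apply: lb_le_inf => // s [/ltW]. Qed.

Let D0 : D 0. Proof. by have [t _] := absD 0; rewrite scaler0. Qed.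

Lemma gauge_le1 x : D x -> gauge x <= 1.
Proof. by move=> Dx; apply: gauge_le; rewrite // invr1 scale1r. Qed.

(** If [t^-1 *: x] were in [D] with [t < 1], then [x] would be its convex combination with [0], of
    weights [t] and [1 - t], hence in [D]. *)
Lemma gauge_ge1 x : ~ D x -> 1 <= gauge x.
Proof.
move=> nDx; apply: lb_le_inf => // t [t0 Dx]; rewrite leNgt; apply/negP => t1.
apply: nDx; have := (convex_setP D).1 convD _ _ _ _ (ltW t0) _ (subrKC t 1) Dx D0.
by rewrite scaler0 addr0 scalerA divff ?gt_eqF // scale1r subr_ge0 ltW //; apply.
Qed.

Lemma gauge_sublinear : sublinear gauge.
Proof.
apply: sublinearW => [|x y|t x t0].
- apply/eqP; rewrite eq_le gauge_ge0 andbT; apply/ler_addgt0Pr => e e0.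
  by rewrite add0r; apply: gauge_le; rewrite ?scaler0.
- apply: le_inf_add => // s t [s0 Dx] [t0 Dy].
  have st0 : 0 < s + t by exact: addr_gt0.
  apply: gauge_le => //.
  (* With these weights the combination of [s^-1 *: x] and [t^-1 *: y] is
     [(s + t)^-1 *: (x + y)]. *)
  have := (convex_setP D).1 convD _ _ (s / (s + t)) (t / (s + t)) _ _ _ Dx Dy.
  rewrite !scalerA ![_ / (s + t)]mulrC -!mulrA !divff ?gt_eqF // !mulr1 -scalerDr.
  by apply; rewrite ?mulr_ge0 ?invr_ge0 ?ltW // -mulrDr mulVf ?gt_eqF.
- apply: le_mul_inf => // s [s0 Dx]; apply: gauge_le; first exact: mulr_gt0.
  by rewrite invfM scalerA mulrAC mulVf ?gt_eqF // mul1r.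
Qed.

End Gauge.

(** * Convex hulls, infinite suprema and restriction of scalars *)

Lemma convex_hull_convex (K : numDomainType) (V : lmodType K) (A : set V) :
  convex_set (convex_hull A).
Proof.
apply/convex_setP => x y a b a0 b0 ab hx hy C [cC AC].
by apply: (convex_setP C).1 => //; [exact: hx|exact: hy].
Qed.

Lemma ereal_sup_image_pinfty (R : realType) (T : Type) (A : set T) (g : T -> R) :
  A !=set0 ->
  ereal_sup [set (g y)%:E | y in A] = +oo%E <->
  forall M, ~ forall y, A y -> g y <= M.
Proof.
move=> [a Aa]; split=> [supA M gM|gA].
  have : (ereal_sup [set (g y)%:E | y in A] <= M%:E)%E.
    by apply: ge_ereal_sup => _ [y Ay <-]; rewrite lee_fin gM.
  by rewrite supA.
rewrite -[X in ereal_sup X](image_comp g EFin); apply: hasNub_ereal_sup.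
  by case=> M gM; apply: (gA M) => y Ay; apply: gM; exists y.
by exists (g a), a.
Qed.

(** An alias of [V] that can carry a second module structure, over [R]; [iota] occurs as a parameter
    so that the type determines the scaling. *)
Definition restrict_scalars (R K : pzRingType) (iota : {rmorphism R -> K})
  (V : lmodType K) : Type := V.

Section RestrictScalars.
Variables (R K : pzRingType) (iota : {rmorphism R -> K}) (V : lmodType K).
Local Notation VR := (restrict_scalars iota V).

HB.instance Definition _ := GRing.Zmodule.on VR.

Let scale (a : R) (v : VR) : VR := iota a *: (v : V).

Let scaleA a b v : scale a (scale b v) = scale (a * b) v.
Proof. by rewrite /scale scalerA rmorphM. Qed.

Let scale1 : left_id 1 scale.
Proof. by move=> v; rewrite /scale rmorph1 scale1r. Qed.

Let scaleDr : right_distributive scale +%R.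
Proof. by move=> a u v; rewrite /scale scalerDr. Qed.

Let scaleDl v : {morph scale^~ v : a b / a + b}.
Proof. by move=> a b; rewrite /scale rmorphD scalerDl. Qed.

HB.instance Definition _ := GRing.Zmodule_isLmodule.Build R VR
  scaleA scale1 scaleDr scaleDl.

End RestrictScalars.

(* [iota] is the embedding of the reals into [K]; both [K = R] and [K = R[i]]
   satisfy the two hypotheses. *)
Section RealSeparation.
Variables (R : realType) (K : numFieldType) (iota : {rmorphism R -> K}).
Hypothesis iota_le : {mono iota : a b / a <= b}.
Hypothesis iota_surj : forall k, 0 <= k -> exists a, k = iota a.

Let iota_ge0 a : (0 <= iota a) = (0 <= a).
Proof. by rewrite -(rmorph0 iota) iota_le. Qed.

Let iota_lt : {mono iota : a b / a < b}.
Proof. exact: leW_mono. Qed.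

Let iota_gt0 a : (0 < iota a) = (0 < a).
Proof. by rewrite -(rmorph0 iota) iota_lt. Qed.

Lemma embedding_norm a : `|iota a| = iota `|a|.
Proof.
have [a0|a0] := leP 0 a; first by rewrite !ger0_norm ?iota_ge0.
by rewrite !ltr0_norm ?rmorphN // -(rmorph0 iota) iota_lt.
Qed.

Let iota_gt0P (k : K) : 0 < k -> exists2 a, 0 < a & k = iota a.
Proof.
move=> k0; have [a ka] := iota_surj (ltW k0).
by exists a => //; rewrite -iota_gt0 -ka.
Qed.

(** * Separation and the density criterion for real-linear functionals *)

Variable X : tvsType K.
Local Notation XR := (restrict_scalars iota X).

Lemma nbhs0_absorbing (U : set X) x :
  nbhs 0 U -> exists2 t, 0 < t & U (iota t *: x).
Proof.
move=> U0; have /= := @scale_continuous K X (0, x) U.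
rewrite scale0r => /(_ U0)[[/= B1 B2] [/= B10 B2x] BU].
have [e /= e0 eB] := (nbhs_ballP _ _).1 B10.
have [a a0 ea] := iota_gt0P e0.
(* Halving the radius puts the scalar strictly inside the ball around [0]. *)
have a20 : 0 < a / 2 by rewrite divr_gt0.
exists (a / 2) => //; apply: (BU (iota (a / 2), x)); split => /=.
  apply: eB; rewrite -ball_normE /= sub0r normrN embedding_norm gtr0_norm // ea.
  by rewrite iota_lt ltr_pdivrMr // ltr_pMr // ltr1n.
exact: nbhs_singleton.
Qed.

Lemma restrict_scalars_linearZ (f : {linear XR -> R^o}) a (x : X) :
  f (iota a *: x) = a * f x.
Proof. exact: (linearZ_LR f a (x : XR)). Qed.

(** A one-sided bound suffices: an increment lying in both [(e / 2) U] and [- (e / 2) U] has its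
    image under [f] between [- e / 2] and [e / 2]. *)
Lemma bounded_above_continuous (f : {linear XR -> R^o}) (U : set X) :
  nbhs 0 U -> (forall u, U u -> f u <= 1) -> continuous (f : X -> R^o).
Proof.
move=> U0 fU x; apply/cvgrPdist_lt => e e0.
have e20 : 0 < e / 2 by rewrite divr_gt0.
have e2 : e / 2 < e by rewrite ltr_pdivrMr // ltr_pMr // ltr1n.
have k0 : iota (e / 2) != 0 by rewrite gt_eqF // iota_gt0.
have kN0 : iota (- (e / 2)) != 0 by rewrite rmorphN oppr_eq0.
have := filterI (nbhs0Z k0 U0) (nbhs0Z kN0 U0).
move=> /(_ (nbhs_filter (0 : X)))/(nbhsT x).
apply: filterS => _ [_ [[u Uu <-] [v Uv uv]] <-] /=.
have -> : f x - f (x + iota (e / 2) *: u) = - f (iota (e / 2) *: u).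
  by rewrite (raddfD f) /= opprD addNKr.
rewrite normrN ltr_norml; apply/andP; split.
  rewrite -uv restrict_scalars_linearZ mulNr ltrN2.
  by rewrite (le_lt_trans _ e2) // ler_piMr ?fU // ltW.
rewrite restrict_scalars_linearZ.
by rewrite (le_lt_trans _ e2) // ler_piMr ?fU // ltW.
Qed.

(** Choose a convex open [V] around [0] with [z + V] disjoint from [C]. Then [D = C - x0 - V] is
    convex, absorbing and misses [z - x0], so Hahn-Banach applied to its gauge gives [f <= 1] on [D]
    and [f (z - x0) >= 1]. *)
Lemma not_dense_convex_separation (C : set X) :
  convex_set C -> C !=set0 -> ~ dense C ->
  exists f : {linear XR -> R^o}, [/\ continuous (f : X -> R^o),
    exists w, f w != 0 & exists M, forall c, C c -> f c <= M].
Proof.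
move=> convC [x0 Cx0] /denseNE[O [[z [oO Oz]] OC]].
have [B convB [openB /(_ 0) basisB]] := @locally_convex K X.
have := nbhsB (- z) (open_nbhs_nbhs (conj oO Oz)); rewrite addNr => /basisB.
case=> V [BV V0] VO.
have V_nbhs : nbhs 0 V by apply: open_nbhs_nbhs; split=> //; exact: openB.
have convV : convex_set V by apply: convB; rewrite inE.
pose D : set XR := [set d | exists c v, [/\ C c, V v & d = c - x0 - v :> X]].
have convD : convex_set D.
  apply/convex_setP => _ _ a b a0 b0 ab [c [v [Cc Vv ->]]] [c' [v' [Cc' Vv' ->]]].
  have iab : iota a + iota b = 1 by rewrite -rmorphD ab rmorph1.
  exists (iota a *: c + iota b *: c'), (iota a *: v + iota b *: v'); split.
  - by apply: (convex_setP C).1; rewrite ?iota_ge0.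
  - by apply: (convex_setP V).1; rewrite ?iota_ge0.
  - rewrite -[x0 in RHS]scale1r -iab scalerDl !opprD.
    by rewrite [X in _ = X + _]addrACA [RHS]addrACA -!scalerBr.
have absD x : exists2 t, 0 < t & D (t *: x).
  have [t t0 Vt] := nbhs0_absorbing (- x : X) V_nbhs.
  exists t => //; exists x0, (iota t *: (- x : X)); split=> //.
  by rewrite subrr sub0r scalerN opprK.
pose w : X := z - x0.
have nDw : ~ D w.
  case=> c [v [Cc Vv]]; rewrite /w => zcv.
  have [o Oo ov] := VO v Vv.
  suff : (O `&` C) c by rewrite OC.
  split=> //.
  have zE : z = c - v by apply: (addIr (- x0)); rewrite zcv addrAC.
  suff <- : o = c by [].
  by rewrite -[o](addNKr z) ov zE subrK.
have [f [f_le fw]] := hahn_banach_sublinear (w : XR) (gauge_sublinear convD absD).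
have fD c v : C c -> V v -> f (c - x0 - v) <= 1.
  move=> Cc Vv; apply: le_trans (f_le _) _.
  by apply: gauge_le1; exists c, v.
exists f; split.
(* Taking [c = x0] shows that [- V] lies in [D], so [f] is at most [1] on a neighbourhood of [0]. *)
- apply: (bounded_above_continuous (nbhs0N V_nbhs)) => _ [v Vv <-].
  by have := fD _ _ Cx0 Vv; rewrite subrr sub0r.
- by exists w; rewrite gt_eqF // fw (lt_le_trans ltr01) // gauge_ge1.
- exists (1 + f x0) => c Cc; rewrite -lerBlDr -(raddfB f).
  by have := fD _ _ Cc V0; rewrite subr0.
Qed.

(** Stated for real-linear functionals, this covers the real and the complex case at once. *)
Theorem dense_convex_hullP (A : set X) : A !=set0 ->
  dense (convex_hull A) <->
  forall f : {linear XR -> R^o},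
    continuous (f : X -> R^o) -> (exists w, f w != 0) ->
    ereal_sup [set (f y)%:E | y in A] = +oo%E.
Proof.
move=> A0; split=> [dA f cf [w fw]|supA].
  apply/ereal_sup_image_pinfty => // M fM.
  have f_le y : convex_hull A y -> f y <= M.
    apply: (@smallest_sub _ (@convex_set K X) A [set y : X | f y <= M]) => //.
    apply/convex_setP => {}y z k l k0 l0.
    have [[a ka] [b lb]] := (iota_surj k0, iota_surj l0).
    move: k0 l0; rewrite ka lb !iota_ge0 -rmorphD -(rmorph1 iota).
    move=> a0 b0 /(fmorph_inj iota) ab /= fy fz.
    rewrite (raddfD f) /= !restrict_scalars_linearZ -[M]mul1r -ab mulrDl.
    by rewrite lerD // ler_wpM2l.
  (* This open half-space avoids the hull, yet it contains a multiple of [w] at which [f] equals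
     [M + 1]. *)
  have [] := dA [set y : X | M < f y].
  - exists (iota ((M + 1) / f w) *: w) => /=.
    by rewrite restrict_scalars_linearZ divfK // ltrDl.
  - apply: (open_comp (f := f : X -> R^o) (D := [set r | M < r])) => [? _|].
      exact: cf.
    exact: open_gt.
  - by move=> y [/= My /f_le]; rewrite leNgt My.
apply: contrapT => /not_dense_convex_separation.
case=> [||f [cf f0 [M fM]]].
- exact: convex_hull_convex.
- by have [a Aa] := A0; exists a; exact: sub_gen_smallest.
- apply: ((ereal_sup_image_pinfty f A0).1 (supA f cf f0) M) => y Ay.
  by apply: fM; exact: sub_gen_smallest.
Qed.

End RealSeparation.

(** * Complex functionals and their real parts *)

Lemma scale_continuous_right (K : numFieldType) (X : tvsType K) (k : K) :
  continuous (fun x : X => k *: x).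
Proof.
move=> x U /(@scale_continuous K X (k, x))[[B1 B2] [/= B1k B2x] BU].
apply: filterS B2x => z B2z; apply: (BU (k, z)).
by split=> //=; exact: nbhs_singleton.
Qed.

Section ComplexFunctional.
Variables (R : realType) (X : tvsType R[i]).
Local Notation XR := (restrict_scalars (real_complex R) X).

Section Complexify.
Variable f : {linear XR -> R^o}.

Definition complexify (x : X) : R[i] := Complex (f x) (- f ('i%C *: x)).

Let fZ k (x : X) :
  f (k *: x) = complex.Re k * f x + complex.Im k * f ('i%C *: x).
Proof.
rewrite {1}[k]complexE scalerDl (raddfD f) mulrC -scalerA.
by rewrite -!(restrict_scalars_linearZ f).
Qed.

(** Splitting [k] into real and imaginary parts reduces complex homogeneity to
    [f (i (i x)) = - f x]. *)
Lemma complexify_linear : linear (complexify : X -> R[i]^o).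
Proof.
have fii x : f ('i%C *: ('i%C *: x)) = - f x.
  by rewrite scalerA -expr2 sqr_i scaleN1r (raddfN f).
move=> k x y; rewrite /complexify scalerDr scalerA mulrC -scalerA.
rewrite !(raddfD f) /= !(fZ k) fii; case: k => a b /=.
apply/eqP; rewrite eq_complex /=; apply/andP; split; apply/eqP; ring.
Qed.

Lemma complexify_continuous : continuous (f : X -> R^o) ->
  continuous (complexify : X -> R[i]^o).
Proof.
move=> cf x; apply/cvgrPdist_lt => e e0.
(* Positivity in [R[i]] forces the imaginary part to vanish, so [e] is real and can be shared
   equally between the two components. *)
have [a0 ->] : 0 < complex.Re e /\ e = (complex.Re e)%:C%C.
  by case: e e0 => a b; rewrite ltcE /= => /andP[/eqP ->].
have a20 : 0 < complex.Re e / 2 by rewrite divr_gt0.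
have cfi : f ('i%C *: y) @[y --> x] --> f ('i%C *: x).
  apply: (@cvg_comp _ _ _ (fun y : X => 'i%C *: y) f); last exact: cf.
  exact: scale_continuous_right.
have /cvgrPdist_lt/(_ _ a20) fx := cf x.
have /cvgrPdist_lt/(_ _ a20) fiX := cfi.
near=> y.
rewrite [X in `|X|]complexE (le_lt_trans (ler_normD _ _)) //.
have -> : `|'i%C * (complex.Im (complexify x - complexify y))%:C%C| =
    `|(complex.Im (complexify x - complexify y))%:C%C| :> R[i].
  by rewrite normrM (normc_def 'i%C) /= !expr2 mul0r mul1r add0r sqrtr1 mul1r.
rewrite !(embedding_norm (@lecR R)) -rmorphD ltcR (splitr (complex.Re e)) ltrD //=.
  by near: y.
by rewrite -opprD normrN; near: y.
Unshelve. all: by end_near. Qed.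

End Complexify.

Lemma Re_linear (F : {linear X -> R[i]^o}) :
  linear ((fun x => complex.Re (F x)) : XR -> R^o).
Proof.
move=> a x y; rewrite (linearP F (a%:C%C) (x : X) (y : X)).
by case: (F x) (F y) => [b c] [b' c'] /=; rewrite mul0r subr0.
Qed.

Lemma Re_continuous (g : X -> R[i]^o) :
  continuous g -> continuous ((fun x => complex.Re (g x)) : X -> R^o).
Proof.
move=> cg x; apply/cvgrPdist_lt => e; rewrite -ltcR => e0.
have /cvgrPdist_lt/(_ _ e0) := cg x; apply: filterS => y gxy.
by rewrite -raddfB -ltcR (le_lt_trans (normc_ge_Re _)).
Qed.

End ComplexFunctional.

Theorem corollary2p2 (R : realType) :
  (forall (X : tvsType R) (T : {linear X -> X}) (x : X),
     continuous T ->
     dense (convex_hull (Orb T x)) <->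
     (forall f : {linear X -> R^o},
        continuous f -> (exists y : X, f y != 0) ->
        ereal_sup [set (f y)%:E | y in Orb T x] = +oo%E))
  /\
  (forall (X : tvsType R[i]) (T : {linear X -> X}) (x : X),
     continuous T ->
     dense (convex_hull (Orb T x)) <->
     (forall f : {linear X -> R[i]^o},
        continuous f -> (exists y : X, f y != 0) ->
        ereal_sup [set (complex.Re (f y))%:E | y in Orb T x] = +oo%E)).
Proof.
have Orb0 (U : Type) (T : U -> U) x : Orb T x !=set0 by exists x, 0%N.
split=> X T x _.
  have id_le : {mono (idfun : {rmorphism R -> R}) : a b / a <= b} by [].
  have id_surj (k : R) : 0 <= k -> exists a, k = idfun a by exists k.
  rewrite (dense_convex_hullP id_le id_surj) //; split=> supX f cf [w fw].
    (* Scaling through [idfun] is convertible to the original scaling, so [linearP f] serves for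
       both module structures. *)
    pose F := GRing.isLinear.Build R (restrict_scalars idfun X) R^o *:%R f (linearP f).
    pose g : {linear restrict_scalars idfun X -> R^o} := HB.pack (f : X -> R^o) F.
    by apply: (supX g) => //; exists w.
  pose F := GRing.isLinear.Build R X R^o *:%R f (linearP f).
  pose g : {linear X -> R^o} := HB.pack (f : X -> R^o) F.
  by apply: (supX g) => //; exists w.
have C_surj (k : R[i]) : 0 <= k -> exists a, k = real_complex R a.
  by move=> /ger0_real/complex_realP.
rewrite (dense_convex_hullP (@lecR R) C_surj) //; split=> supX f cf [w fw].
  pose XR := restrict_scalars (real_complex R) X.
  pose F := GRing.isLinear.Build R XR R^o *:%R _ (Re_linear f).
  pose g : {linear XR -> R^o} := HB.pack (fun x : X => complex.Re (f x)) F.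
  apply: (supX g); first exact: Re_continuous.
  (* The real part of [f w] may vanish although [f w] does not; rescaling makes the value [1]. *)
  exists ((f w)^-1 *: w) => /=.
  by rewrite (_ : f _ = 1) ?oner_neq0 // linearZ; exact: mulVf.
pose F := GRing.isLinear.Build R[i] X R[i]^o *:%R _ (complexify_linear f).
pose g : {linear X -> R[i]^o} := HB.pack (complexify f) F.
apply: (supX g); first exact: complexify_continuous.
exists w; apply: contra_neq fw => /(congr1 (@complex.Re R)); exact.
Qed.
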